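(* For all integers $n\ge0$ and $c\ge1$, \begin{align*} t_n^{(c)}=&\ \frac{n!}{12}\sum_{k=0}^{n-1}(-1)^k\frac{c^{n-k}(n-k-1)(3n+k)}{k!}\\ &+n!\sum_{k=0}^{n}\frac{(-1)^k}{k!}\sum_{i=0}^{(n-k)(c-1)} i\sum_{j=0}^{n-k}(-1)^j\binom{n-k}{j}\binom{i-cj+n-k-1}{n-k-1}\\ &+\frac{n!(c-1)}{2}\sum_{k=0}^{n}\frac{(-1)^k c^{n-k}}{k!}\binom{n-k}{2}\\ &+\frac{n!(c-1)}{6}\sum_{k=1}^{n-1}\frac{(-1)^k c^{n-k}(2(n-k)+1)}{(k-1)!}. \end{align*}
   Context: For integers $n\ge0$, $c\ge1$, let $G_{c,n}$ be the set of colored permutations: words $\sigma=\sigma_1^{[c_1]}\cdots\sigma_n^{[c_n]}$ where $|\sigma|=\sigma_1\cdots\sigma_n$ is a permutation of $[n]$ and each color $c_i\in\{0,\dots,c-1\}$. For a permutation $\pi$ of $[n]$, $\mathrm{inv}(\pi)=|\{(i,j):i<j,\ \pi_i>\pi_j\}|$. Let $\mathrm{col}(\sigma)=c_1+\cdots+c_n$ and $\mathrm{inv}_c(\sigma)=\mathrm{inv}(|\sigma|)+\mathrm{col}(\sigma)+c\cdot|\{(i,j):1\le i<j\le n,\ \sigma_i<\sigma_j,\ c_j\ne0\}|$. A colored derangement is a $\sigma\in G_{c,n}$ having no index $i$ with $\sigma_i=i$ and $c_i=0$ (i.e. fixed points of the underlying permutation must carry a nonzero color). $t_n^{(c)}=\sum\mathrm{inv}_c(\sigma)$,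 summed over all colored derangements $\sigma\in G_{c,n}$. Binomial coefficients follow the convention $\binom{m}{r}=0$ unless $0\le r\le m$. *)

(* Defs.v *)
From mathcomp Require Import all_boot all_order all_algebra all_fingroup.

Set Implicit Arguments.
Unset Strict Implicit.
Unset Printing Implicit Defensive.

Import Order.TTheory GRing.Theory Num.Theory.

Local Open Scope nat_scope.

(* Positions and letters are both numbered from 0, i.e. 'I_n stands for [n]; the
   statistics and the fixed-point condition below are unaffected by this shift.
   Colors keep their values 0, ..., c - 1. *)
Notation colored_perm n c := ('S_n * {ffun 'I_n -> 'I_c})%type.

Definition uperm (n c : nat) (s : colored_perm n c) : 'S_n := s.1.

Definition color (n c : nat) (s : colored_perm n c) (i : 'I_n) : 'I_c := s.2 i.

Definition inv (n : nat) (p : 'S_n) : nat :=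
  #|[set ij : 'I_n * 'I_n | (ij.1 < ij.2) && (p ij.2 < p ij.1)]|.

Definition col (n c : nat) (s : colored_perm n c) : nat :=
  \sum_(i < n) color s i.

Definition invc (n c : nat) (s : colored_perm n c) : nat :=
  inv (uperm s) + col s
  + c * #|[set ij : 'I_n * 'I_n |
             [&& ij.1 < ij.2,
                 uperm s ij.1 < uperm s ij.2 &
                 color s ij.2 != 0 :> nat]]|.

Definition colored_derangement (n c : nat) (s : colored_perm n c) : bool :=
  [forall i : 'I_n, ~~ ((uperm s i == i) && (color s i == 0 :> nat))].

Definition invc_derangements (n c : nat) : nat :=
  \sum_(s : colored_perm n c | colored_derangement s) invc s.

Local Open Scope ring_scope.

(* Binomial coefficient that vanishes unless 0 <= r <= m: both arguments may be
   negative integers, which truncated subtraction on nat would misrepresent. *)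
Definition binz (m r : int) : nat :=
  if (0 <= r) && (r <= m) then 'C(`|m|%N, `|r|%N) else 0%N.

(* Main.v *)
(* Inclusion-exclusion over the set [S] of positions that are fixed and have
   color 0 leaves the sum of [invc] over all colored permutations fixing [S]
   with color 0.  Let [m] be the number of positions outside [S], called moved.
   A pair of moved positions is inverted for half of these permutations.  For a
   pair [{s, t}] with [s] in [S] and [t] moved, the image of [t] is uniformly
   distributed over the moved positions, so the contribution of such pairs only
   depends on the numbers of moved positions below and above [s].  Summing
   over the sets [S] of size [k] turns these into counts of triples [a < s < b]
   and of pairs of positions above [s].
   The double sum with binomial coefficients is the derivative at 1 of
   [(1 + X + ... + X^(c-1))^m], whose coefficients are read off from
   [(1 - X^c)^m * (1 - X)^-m]. *)

Require Import Defs.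
From mathcomp Require Import all_boot all_order all_algebra all_fingroup.
From mathcomp Require Import ring zify.

Import Order.TTheory GRing.Theory Num.Theory.
Local Open Scope ring_scope.

(** * Coefficients of powers of a geometric sum *)

(** Multiplying by [1 - 'X] takes differences of consecutive coefficients, which Pascal's rule
    evaluates; the last coefficient leaves the boundary term at ['X^N]. *)
Lemma mul_subX_poly_bin (R : comNzRingType) r N :
  (1 - 'X) * \poly_(i < N) ('C(i + r.+1, r.+1))%:R =
  \poly_(i < N) ('C(i + r, r))%:R - 'C(N + r, r.+1)%:R *: 'X^N :> {poly R}.
Proof.
rewrite !poly_def; elim: N => [|N IHN].
  by rewrite !big_ord0 add0n bin_small // scale0r mulr0 subr0.
rewrite !big_ord_recr /= mulrDr IHN addSn addnS binS natrD exprS -!mul_polyC.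
by rewrite !rmorphD /=; ring.
Qed.

(* The power series of [(1 - X)^-(r + 1)], truncated at order [N]. *)
Lemma negative_binomial (R : comNzRingType) r N :
  exists Q : {poly R},
    (1 - 'X) ^+ r.+1 * \poly_(i < N) ('C(i + r, r))%:R = 1 + 'X^N * Q.
Proof.
elim: r => [|r [Q IHr]].
  (* The base case is the finite geometric sum, equal to [1 - 'X^N] after multiplication by
     [1 - 'X]. *)
  exists (-1); rewrite poly_def expr1 mulrN1.
  under eq_bigr do rewrite bin0 scale1r.
  by rewrite -(opprB 'X 1) mulNr -subrX1 opprB.
exists (Q - 'C(N + r, r.+1)%:R *: (1 - 'X) ^+ r.+1).
rewrite exprSr -mulrA mul_subX_poly_bin mulrBr IHr -!mul_polyC.
by ring.
Qed.

(** Generating polynomial of one color: the coefficient of ['X^i] in its [m]-th power counts the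
    colorings of [m] positions with total color [i]. *)
Definition geom (R : nzRingType) c : {poly R} := \sum_(a < c) 'X^a.

Lemma coef_geom_exp (R : comNzRingType) c r i :
  (geom R c ^+ r.+1)`_i =
  \sum_(j < r.+2) (-1) ^+ j * 'C(r.+1, j)%:R *
     (if c * j <= i then 'C(i - c * j + r, r) else 0)%N%:R.
Proof.
have [Q hQ] := negative_binomial R r i.+1.
(* Truncating the series at order [i.+1] leaves an error divisible by ['X^(i.+1)], invisible in
   coefficient [i]. *)
have e : geom R c ^+ r.+1 =
    (1 - 'X^c) ^+ r.+1 * \poly_(l < i.+1) ('C(l + r, r))%:R
    - 'X^(i.+1) * (Q * geom R c ^+ r.+1).
  have -> : 1 - 'X^c = (1 - 'X) * geom R c :> {poly R}.
    by rewrite -(opprB 'X 1) mulNr -subrX1 opprB.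
  by rewrite exprMn mulrAC hQ; ring.
rewrite e coefB coefXnM ltnSn subr0 exprDn mulr_suml coef_sum.
apply: eq_bigr => j _.
rewrite expr1n mul1r [(- 'X^c) ^+ j]exprNn -exprM mulrnAl -mulrA coefMn.
rewrite -polyC1 -polyCN -polyC_exp coefCM coefXnM coef_poly ltnNge.
rewrite -[_ *+ 'C(_, _)]mulr_natr mulrAC; congr (_ * _).
by rewrite ltnS leq_subr; case: leqP.
Qed.

Lemma size_geom c : (size (geom rat c.+1) <= c.+1)%N.
Proof.
apply: (leq_trans (size_sum _ _ _)); apply/bigmax_leqP => a _.
by rewrite size_polyXn.
Qed.

Lemma deriv_geom_at1 c : 2 * (geom rat c)^`().[1] = c%:R * (c%:R - 1).
Proof.
rewrite /geom; elim: c => [|c IHc].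
  by rewrite big_ord0 deriv0 horner0 mul0r mulr0.
rewrite big_ord_recr /= derivD hornerD mulrDr IHc derivXn hornerMn hornerXn.
by rewrite expr1n -[c.+1]addn1 natrD; ring.
Qed.

(** Both sides are twice the derivative at 1 of [geom rat c ^+ m], since [geom] takes the value [c]
    at 1. *)
Lemma sum_color_totals m c : (0 < c)%N ->
  2 * (\sum_(0 <= i < (m * (c - 1)).+1) i%:R * (geom rat c ^+ m)`_i) =
  m%:R * c%:R ^+ m * (c%:R - 1).
Proof.
case: c => // c _; rewrite subn1 /= big_mkord.
(* Here [c] is one less than the number of colors; the degree bound [m * c] shows that the range of
   [i] misses no coefficient. *)
have sz : (size (geom rat c.+1 ^+ m) <= (m * c).+1)%N.
  apply: leq_trans (size_poly_exp_leq _ _) _; rewrite ltnS mulnC leq_mul2l.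
  by rewrite -ltnS (leq_trans (leqSpred _)) ?orbT //; have := size_geom c; lia.
have -> : \sum_(i < (m * c).+1) i%:R * (geom rat c.+1 ^+ m)`_i =
    (geom rat c.+1 ^+ m)^`().[1].
  rewrite big_ord_recl mul0r add0r.
  rewrite (@horner_coef_wide _ (m * c)).
    by apply: eq_bigr => i _; rewrite expr1n mulr1 coef_deriv mulr_natl.
  apply: leq_trans (_ : (size (geom rat c.+1 ^+ m)).-1 <= _)%N; last by lia.
  have [->|n0] := eqVneq (geom rat c.+1 ^+ m) 0; first by rewrite deriv0 size_poly0.
  by have := lt_size_deriv n0; lia.
rewrite deriv_exp hornerMn hornerM horner_exp.
have -> : (geom rat c.+1).[1] = c.+1%:R.
  rewrite horner_sum; under eq_bigr do rewrite hornerXn expr1n.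
  by rewrite sumr_const card_ord.
rewrite -[X in 2 * X]mulr_natr !mulrA deriv_geom_at1.
(* The exponent [m.-1] left by the derivative is truncated at [m = 0], where the factor [m]
   vanishes. *)
by case: m {sz} => [|m]; rewrite ?mulr0 ?mul0r // exprS /=; ring.
Qed.

(** As [m - 1] is nonnegative, [binz] vanishes exactly when its upper argument drops below [m - 1],
    that is when [c * j] exceeds [i]. *)
Lemma binz_coef (m c i : nat) : (0 < m)%N ->
  \sum_(0 <= j < m.+1)
    (-1) ^+ j * 'C(m, j)%:R * (binz (i%:Z - c%:Z * j%:Z + m%:Z - 1) (m%:Z - 1))%:R
  = (geom rat c ^+ m)`_i.
Proof.
case: m => // r _; rewrite coef_geom_exp big_mkord; apply: eq_bigr => j _.
congr (_ * _%:R); rewrite /binz.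
have -> : (r.+1%:Z - 1) = r%:Z by lia.
have -> : (0 <= r%:Z) by lia.
case: leqP => h /=.
  rewrite ifT; last by lia.
  by congr ('C(_, _)); lia.
by rewrite ifF //; lia.
Qed.

(** * Colored permutations with prescribed fixed points *)

(** Expand the product over [i] of one minus the indicator of [P i]. *)
Lemma inclusion_exclusion (R : comNzRingType) (I : finType) (P : pred I) :
  [forall i, ~~ P i]%:R =
  \sum_(S : {set I}) (-1) ^+ #|S| * [forall i in S, P i]%:R :> R.
Proof.
have prod_nat (Q : pred I) : \prod_i (Q i)%:R = [forall i, Q i]%:R :> R.
  case: forallP => [h|/forallP/forallPn[i /negbTE Qi]].
    by rewrite big1 // => i _; rewrite h.
  by rewrite (bigD1 i) //= Qi mul0r.
rewrite -prod_nat.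
transitivity (\prod_i (- (P i)%:R + 1 : R)).
  by apply: eq_bigr => i _; case: (P i); rewrite ?addNr ?oppr0 ?add0r.
rewrite bigA_distr; apply: eq_bigr => S _.
rewrite -prod_nat -prodr_const [X in _ = X * _]big_mkcond /= -big_split /=.
by apply: eq_bigr => i _; case: (i \in S); rewrite /= ?mulN1r ?mulr1.
Qed.

Section MovedPoints.
Variables (T : finType) (A : {set T}).

(** Composing with the transposition of [i] and [a] matches these permutations with those moving
    only points of [A :\ i]. *)
Lemma card_perm_on_eq (i a : T) : i \in A -> a \in A ->
  #|[pred p | perm_on A p & p i == a]| = (#|A|.-1)`!.
Proof.
move=> iA aA; have -> : #|A|.-1 = #|A :\ i| by rewrite (cardsD1 i A) iA.
rewrite -card_perm -!sum1_card.
have tA x y : x \in A -> y \in A -> perm_on A (tperm x y).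
  move=> xA yA; apply: subset_trans (tperm_on x y) _.
  by apply/subsetP => z /set2P[] ->.
rewrite (reindex_inj (mulIg (tperm i a))) /=.
apply: eq_bigl => p; rewrite !inE permM.
apply/andP/idP => [[pA /eqP pi]|pA].
  have fi : p i = i by apply: (@perm_inj _ (tperm i a)); rewrite pi tpermL.
  apply/subsetP => x; rewrite inE => px; rewrite !inE.
  have -> /= : x != i by apply: contraNneq px => ->; rewrite fi.
  have qA : perm_on A p by rewrite -[p](mulgK (tperm i a)) tpermV perm_onM ?tA.
  by apply: (subsetP qA); rewrite inE.
have fi : p i = i by apply: out_perm pA _; rewrite !inE eqxx.
rewrite fi tpermL; split=> //; apply: perm_onM; last exact: tA.
by apply: subset_trans pA (subD1set _ _).
Qed.

Lemma sum_perm_on_value (g : T -> rat) (i : T) : i \in A ->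
  \sum_(p | perm_on A p) g (p i) = (#|A|.-1)`!%:R * \sum_(a in A) g a.
Proof.
move=> iA.
rewrite (partition_big (fun p : {perm T} => p i) [in A]) /=; last first.
  by move=> p pA; rewrite (perm_closed _ pA).
rewrite mulr_sumr; apply: eq_bigr => a aA.
rewrite (eq_bigr (fun _ => g a)) => [|p /andP[_ /eqP->] //].
by rewrite sumr_const -(card_perm_on_eq _ _ iA aA) mulr_natl.
Qed.

(* Composing with the transposition of [i] and [j] exchanges the two orders. *)
Lemma sum_perm_on_sym (g : T -> T -> rat) (i j : T) : i \in A -> j \in A ->
  \sum_(p | perm_on A p) g (p i) (p j) = \sum_(p | perm_on A p) g (p j) (p i).
Proof.
move=> iA jA; rewrite (reindex_inj (mulgI (tperm i j))) /=.
have tA : perm_on A (tperm i j).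
  apply: subset_trans (tperm_on i j) _.
  by apply/subsetP => z /set2P[] ->.
apply: eq_big => [p|p _]; last by rewrite !permM tpermL tpermR.
apply/idP/idP => pA; last exact: perm_onM.
by rewrite -[p](mulKg (tperm i j)) tpermV perm_onM.
Qed.

End MovedPoints.

Section ZeroColors.
Variables (n c : nat).
Hypothesis c_gt0 : (0 < c)%N.
Implicit Types (S : {set 'I_n}) (f : {ffun 'I_n -> 'I_c}).

Definition zero_on S f := [forall i in S, f i == 0 :> nat].

Lemma card_zero_on S : #|[pred f | zero_on S f]| = (c ^ #|~: S|)%N.
Proof.
(* These colorings form a product: one choice at each position of [S], [c] choices elsewhere. *)
pose Q (i : 'I_n) : pred 'I_c := fun a => (i \in S) ==> (a == 0 :> nat).
rewrite (@eq_card _ _ (family Q)); last first.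
  by move=> f; rewrite [LHS]inE; apply/forallP/familyP => h i; exact: h.
rewrite card_family foldrE big_image /=.
rewrite (bigID [in S]) /= big1 ?mul1n => [|i iS]; last first.
  rewrite -(card1 (Ordinal c_gt0)); apply: eq_card => a.
  by rewrite !inE unfold_in /Q iS.
rewrite -prod_nat_const; apply: eq_big => [i|i /negbTE iS]; first by rewrite inE.
rewrite -[RHS]card_ord; apply: eq_card => a.
by rewrite !inE unfold_in /Q iS.
Qed.

Lemma zero_onU1 S j f : zero_on (j |: S) f = (f j == 0 :> nat) && zero_on S f.
Proof.
apply/forall_inP/andP => [h|[h0 /forall_inP h] i].
  split; first exact: (h _ (setU11 _ _)).
  by apply/forall_inP => i iS; apply: h; rewrite inE iS orbT.
by rewrite !inE => /orP[/eqP->|]; [exact: h0 | exact: h].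
Qed.

(** For [j] outside [S], subtract the colorings that also vanish at [j]. The factor [c] on the left
    avoids an exponent [#|~: S| - 1]. *)
Lemma sum_zero_on_neq0 S (j : 'I_n) :
  c%:R * (\sum_(f | zero_on S f) (f j != 0 :> nat)%:R) =
  (j \notin S)%:R * c%:R ^+ #|~: S| * (c%:R - 1) :> rat.
Proof.
have [jS|jS] := boolP (j \in S).
  rewrite big1 ?mulr0 ?mul0r // => f /forall_inP /(_ j jS) /eqP ->.
  by rewrite eqxx.
have card_split : (c ^ #|~: S| =
    c ^ #|~: (j |: S)| + #|[pred f | zero_on S f & f j != 0 :> nat]|)%N.
  rewrite -!card_zero_on.
  rewrite -(cardID [pred f : {ffun 'I_n -> 'I_c} | f j == 0 :> nat]).
  by congr (_ + _)%N; apply: eq_card => f; rewrite !inE ?zero_onU1 // andbC.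
have cS : #|~: S| = #|~: (j |: S)|.+1.
  by rewrite (cardsD1 j (~: S)) inE jS setCU setIC setDE.
rewrite -natr_sum -big_mkcondr sum1_card mul1r -natrX card_split natrD.
move: card_split; rewrite cS => /(congr1 (fun x => x%:R : rat)).
rewrite natrD natrX exprS -natrX natrX => h.
have -> : #|[pred f | zero_on S f & f j != 0 :> nat]|%:R =
   c%:R * c%:R ^+ #|~: (j |: S)| - c%:R ^+ #|~: (j |: S)| :> rat.
  by rewrite h; ring.
by ring.
Qed.

(* Complementing the colors, [a |-> c - 1 - a], outside [S] preserves the
   colorings vanishing on [S]. *)
Lemma sum_zero_on_col S :
  2 * (\sum_(f | zero_on S f) \sum_(i < n) (f i)%:R) =
  #|~: S|%:R * c%:R ^+ #|~: S| * (c%:R - 1) :> rat.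
Proof.
pose comp f := [ffun i => if i \in S then f i else rev_ord (f i)].
have compK : involutive comp.
  by move=> f; apply/ffunP => i; rewrite !ffunE; case: (i \in S); rewrite ?rev_ordK.
have zc f : zero_on S (comp f) = zero_on S f.
  rewrite /zero_on. apply: eq_forallb => i.
  by case iS: (i \in S) => //=; rewrite ffunE iS.
rewrite mulr_natl mulr2n {2}(reindex_inj (inv_inj compK)) /=.
rewrite (eq_bigl _ _ zc) -big_split /=.
rewrite (eq_bigr (fun=> #|~: S|%:R * (c%:R - 1))) => [|f /forall_inP f0].
  by rewrite sumr_const card_zero_on -[LHS]mulr_natr natrX; ring.
rewrite -big_split /= (bigID [in S]) /= big1 ?add0r => [|i iS]; last first.
  by rewrite ffunE iS (eqP (f0 i iS)) addr0.
rewrite (eq_bigr (fun=> c%:R - 1)) => [|i /negbTE iS].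
  rewrite sumr_const mulr_natl; congr (_ *+ _).
  by apply: eq_card => i; rewrite !inE.
rewrite ffunE iS /= -natrD -(@natrB _ c 1) //; congr _%:R.
by have := ltn_ord (f i); lia.
Qed.

End ZeroColors.

(** * The statistic summed over the permutations fixing a set *)

Section FixedSet.
Variables (n : nat) (S : {set 'I_n}).
Implicit Types i j : 'I_n.
Let A := ~: S.
Let m := #|A|.
Let x i : rat := (i \notin S)%:R.
Let y i : rat := (i \in S)%:R.

Definition moved_below i : rat := \sum_j (j \notin S)%:R * (j < i)%N%:R.
Definition moved_above i : rat := \sum_j (j \notin S)%:R * (i < j)%N%:R.

(** Counts triples [a < s < b] with [s] in [S] and [a], [b] moved. *)
Definition fixed_between : rat :=
  \sum_i (i \in S)%:R * (moved_below i * moved_above i).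
(** Counts ordered pairs of moved positions above a common [s] in [S]; the two positions may
    coincide. *)
Definition fixed_below_pairs : rat :=
  \sum_i (i \in S)%:R * (moved_above i * moved_above i).

Lemma sum_moved : \sum_i x i = m%:R.
Proof.
rewrite /x -natr_sum -big_mkcond sum1_card; congr _%:R.
by apply: eq_card => i; rewrite !inE.
Qed.

(** The square of the sum of [x] splits into the pairs [i < j], their mirror images, and the
    diagonal, where [x] is idempotent. *)
Lemma sum_moved_pairs : \sum_(i < n) \sum_(j < n | (i < j)%N) x i * x j =
  m%:R * (m%:R - 1) / 2.
Proof.
set P := LHS.
have sym : P = \sum_(i < n) \sum_(j < n | (j < i)%N) x i * x j.
  rewrite /P (exchange_big_dep xpredT) //=; apply: eq_bigr => i _.
  by apply: eq_bigr => j _; rewrite mulrC.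
have e : m%:R ^+ 2 = P + P + m%:R.
  rewrite {2}sym /P -!big_split /= -sum_moved -big_split expr2 big_distrlr /=.
  apply: eq_bigr => i _.
  rewrite (bigID (fun j : 'I_n => (i < j)%N)) /= -addrA; congr (_ + _).
  rewrite (bigD1 i) ?ltnn //= addrC; congr (_ + _); last first.
    by rewrite /x -natrM mulnb andbb.
  by apply: eq_bigl => j; rewrite -leqNgt ltn_neqAle andbC.
have -> : m%:R * (m%:R - 1) = P + P by rewrite mulrBr mulr1 -expr2 e; ring.
by field.
Qed.

Lemma sum_moved_below i : \sum_(a in A) (a < i)%N%:R = moved_below i.
Proof.
rewrite big_mkcond; apply: eq_bigr => a _.
by rewrite inE; case: (a \in S); rewrite ?mul0r ?mul1r.
Qed.

Lemma sum_moved_above i : \sum_(a in A) (i < a)%N%:R = moved_above i.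
Proof.
rewrite big_mkcond; apply: eq_bigr => a _.
by rewrite inE; case: (a \in S); rewrite ?mul0r ?mul1r.
Qed.

(** The two orders of the images are equally frequent by symmetry, and exactly one of them
    occurs. *)
Lemma sum_perm_on_lt_moved i j : i \in A -> j \in A -> i != j ->
  \sum_(p | perm_on A p) (p i < p j)%N%:R = m`!%:R / 2 :> rat.
Proof.
move=> iA jA ij; set L := LHS.
have e : L + L = m`!%:R.
  rewrite {2}/L (sum_perm_on_sym _ _ (fun a b : 'I_n => (a < b)%N%:R)) //.
  rewrite -big_split /= -card_perm -sum1_card natr_sum.
  apply: eq_bigr => p _; rewrite -natrD.
  have : p i != p j by rewrite (inj_eq perm_inj).
  by rewrite -val_eqE /=; case: ltngtP.
by rewrite -e; field.
Qed.

(** Two fixed positions are never inverted. If only one is fixed, the image of the other is uniform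
    over [A], and the pair is inverted when it lands below [i] ([i] fixed) or above [j] ([j]
    fixed). *)
Lemma sum_perm_on_gt i j : (i < j)%N ->
  \sum_(p | perm_on A p) (p j < p i)%N%:R =
  x i * x j * (m`!%:R / 2) + y i * x j * (m.-1`!%:R * moved_below i)
  + x i * y j * (m.-1`!%:R * moved_above j).
Proof.
move=> ij; have nij : i != j by rewrite -val_eqE /= ltn_eqF.
rewrite /x /y; case iS: (i \in S); case jS: (j \in S);
  rewrite /= ?(mul0r, mul1r, add0r, addr0).
- apply: big1 => p pA; rewrite !(out_perm pA) ?inE ?iS ?jS //.
  by rewrite ltnNge ltnW.
- rewrite -sum_moved_below.
  rewrite -(sum_perm_on_value _ _ (fun a : 'I_n => (a < i)%N%:R) j) ?inE ?jS //.
  by apply: eq_bigr => p pA; rewrite (@out_perm _ _ _ i pA) // inE iS.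
- rewrite -sum_moved_above.
  rewrite -(sum_perm_on_value _ _ (fun a : 'I_n => (j < a)%N%:R) i) ?inE ?iS //.
  by apply: eq_bigr => p pA; rewrite (@out_perm _ _ _ j pA) // inE jS.
- by rewrite sum_perm_on_lt_moved ?inE ?iS ?jS // eq_sym.
Qed.

(** The weight [x j] reflects that a nonzero color at [j] forces [j] outside [S]. *)
Lemma sum_perm_on_lt i j : (i < j)%N ->
  x j * (\sum_(p | perm_on A p) (p i < p j)%N%:R) =
  x i * x j * (m`!%:R / 2) + y i * x j * (m.-1`!%:R * moved_above i).
Proof.
move=> ij; have nij : i != j by rewrite -val_eqE /= ltn_eqF.
rewrite /x /y; case jS: (j \in S); rewrite /= ?(mulr0, mul0r, add0r) //.
case iS: (i \in S); rewrite /= ?(mul0r, mul1r, add0r, addr0).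
- rewrite -sum_moved_above.
  rewrite -(sum_perm_on_value _ _ (fun a : 'I_n => (i < a)%N%:R) j) ?inE ?jS //.
  by apply: eq_bigr => p pA; rewrite (@out_perm _ _ _ i pA) // inE iS.
- by rewrite sum_perm_on_lt_moved ?inE ?iS ?jS.
Qed.

Lemma sum_fixed_above (g : 'I_n -> rat) :
  \sum_(i < n) \sum_(j < n | (i < j)%N) y i * x j * g i =
  \sum_i y i * (g i * moved_above i).
Proof.
apply: eq_bigr => i _; rewrite big_mkcond !mulr_sumr.
by apply: eq_bigr => j _; case: ltnP => _; rewrite ?(mulr0, mulr1) // /x; ring.
Qed.

Lemma sum_fixed_below (g : 'I_n -> rat) :
  \sum_(i < n) \sum_(j < n | (i < j)%N) x i * y j * g j =
  \sum_j y j * (moved_below j * g j).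
Proof.
rewrite (exchange_big_dep xpredT) //=; apply: eq_bigr => j _.
rewrite big_mkcond mulr_suml mulr_sumr.
by apply: eq_bigr => i _; case: ltnP => _; rewrite ?(mulr0, mul0r, mulr1) // /x; ring.
Qed.

Lemma natr_inversions (p : 'S_n) :
  (Defs.inv p)%:R = \sum_(i < n) \sum_(j < n | (i < j)%N) (p j < p i)%N%:R :> rat.
Proof.
rewrite /Defs.inv -sum1dep_card natr_sum big_mkcond.
rewrite -(pair_bigA _ (fun i j =>
  if (i < j)%N && (p j < p i)%N then 1%:R else 0)) /=.
apply: eq_bigr => i _; rewrite [RHS]big_mkcond.
by apply: eq_bigr => j _; case: ltnP => //= _; case: ltnP.
Qed.

(** Pairs with the fixed position on the left and those with it on the right both contribute
    [fixed_between], hence the factor 2. *)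
Lemma sum_perm_on_inv :
  \sum_(p | perm_on A p) (Defs.inv p)%:R =
  m`!%:R * (m%:R * (m%:R - 1) / 4) + m.-1`!%:R * (2 * fixed_between).
Proof.
under eq_bigr do rewrite natr_inversions.
rewrite exchange_big /=; under eq_bigr do rewrite exchange_big /=.
under eq_bigr => i _ do under eq_bigr => j ij do rewrite sum_perm_on_gt //.
under eq_bigr do rewrite !big_split /=.
rewrite !big_split /= sum_fixed_above sum_fixed_below.
under eq_bigr do rewrite -mulr_suml.
rewrite -mulr_suml sum_moved_pairs.
have -> : \sum_i y i * (m.-1`!%:R * moved_below i * moved_above i) =
    m.-1`!%:R * fixed_between.
  by rewrite mulr_sumr; apply: eq_bigr => i _; rewrite /y; ring.
have -> : \sum_i y i * (moved_below i * (m.-1`!%:R * moved_above i)) =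
    m.-1`!%:R * fixed_between.
  by rewrite mulr_sumr; apply: eq_bigr => i _; rewrite /y; ring.
by field.
Qed.

(** For fixed [i] and moved [j], both the position [j] and its image range over the moved points
    above [i], whence the square in [fixed_below_pairs]. *)
Lemma sum_perm_on_noninv :
  \sum_(i < n) \sum_(j < n | (i < j)%N) x j * (\sum_(p | perm_on A p) (p i < p j)%N%:R) =
  m`!%:R * (m%:R * (m%:R - 1) / 4) + m.-1`!%:R * fixed_below_pairs.
Proof.
under eq_bigr => i _ do under eq_bigr => j ij do rewrite sum_perm_on_lt //.
under eq_bigr do rewrite !big_split /=.
rewrite !big_split /= sum_fixed_above.
under eq_bigr do rewrite -mulr_suml.
rewrite -mulr_suml sum_moved_pairs.
have -> : \sum_i y i * (m.-1`!%:R * moved_above i * moved_above i) =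
    m.-1`!%:R * fixed_below_pairs.
  by rewrite mulr_sumr; apply: eq_bigr => i _; rewrite /y; ring.
by field.
Qed.

Lemma natr_invc c (p : 'S_n) (f : {ffun 'I_n -> 'I_c}) :
  (invc (p, f))%:R = (Defs.inv p)%:R + \sum_i (f i)%:R
    + c%:R * \sum_(i < n) \sum_(j < n | (i < j)%N)
        (p i < p j)%N%:R * (f j != 0 :> nat)%:R :> rat.
Proof.
rewrite /invc /col /uperm /color /= !natrD natrM natr_sum; congr (_ + _ * _).
rewrite -sum1dep_card natr_sum big_mkcond.
rewrite -(pair_bigA _ (fun i j =>
  if [&& i < j, p i < p j & f j != 0 :> nat]%N then 1%:R else 0)) /=.
apply: eq_bigr => i _; rewrite [RHS]big_mkcond.
apply: eq_bigr => j _; case: ltnP => //= _.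
by rewrite -natrM mulnb; case: andP.
Qed.

(** Permutation and coloring vary independently, so the sum of each of the three parts of [invc]
    factors. *)
Lemma sum_invc_fixing c : (0 < c)%N ->
  \sum_(p | perm_on A p) \sum_(f : {ffun 'I_n -> 'I_c} | zero_on _ _ S f)
    (invc (p, f))%:R =
  c%:R ^+ m * (m`!%:R * (m%:R * (m%:R - 1) / 4 + m%:R * (c%:R - 1) / 2
                           + (c%:R - 1) * (m%:R * (m%:R - 1)) / 4)
               + m.-1`!%:R * (2 * fixed_between + (c%:R - 1) * fixed_below_pairs)).
Proof.
move=> c_gt0; under eq_bigr => p _ do under eq_bigr => f _ do rewrite natr_invc.
under eq_bigr do rewrite !big_split /= sumr_const card_zero_on // -[_ *+ _]mulr_natr.
rewrite !big_split /= -mulr_suml sum_perm_on_inv.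
rewrite sumr_const card_perm -/m -[X in _ + X + _]mulr_natl natrX.
have -> : \sum_(p | perm_on A p) \sum_(f : {ffun 'I_n -> 'I_c} | zero_on _ _ S f)
    c%:R * (\sum_(i < n) \sum_(j < n | (i < j)%N)
      (p i < p j)%N%:R * (f j != 0 :> nat)%:R) =
    c%:R ^+ m * (c%:R - 1) *
    \sum_(i < n) \sum_(j < n | (i < j)%N) x j * (\sum_(p | perm_on A p) (p i < p j)%N%:R).
  (* The sum over colorings is moved innermost, where the factor [c] of [invc] meets
     [sum_zero_on_neq0]. *)
  under eq_bigr => p _.
    rewrite -mulr_sumr exchange_big /=.
    under eq_bigr => i _.
      rewrite exchange_big /=.
      under eq_bigr do rewrite -mulr_sumr.
      over.
    rewrite mulr_sumr.
    under eq_bigr => i _.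
      rewrite mulr_sumr.
      under eq_bigr do rewrite mulrCA sum_zero_on_neq0 //.
      over.
    over.
  rewrite exchange_big mulr_sumr; apply: eq_bigr => i _.
  rewrite exchange_big mulr_sumr; apply: eq_bigr => j _.
  by rewrite -mulr_suml -/(x j); ring.
rewrite sum_perm_on_noninv.
have := sum_zero_on_col n c c_gt0 S; rewrite -/m.
set F := \sum_(f | _) _; move=> hF.
have -> : F = m%:R * c%:R ^+ m * (c%:R - 1) / 2 by rewrite -hF; field.
by field.
Qed.

End FixedSet.

(** * Summing over the fixed sets *)

(** Deleting [s] gives a bijection onto the [k]-subsets of the complement of [s |: B]. *)
Lemma card_draws_avoiding (T : finType) (s : T) (B : {set T}) k : s \notin B ->
  #|[set S : {set T} | [&& #|S| == k.+1, s \in S & [disjoint S & B]]]| =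
  'C(#|T| - #|B|.+1, k).
Proof.
move=> sB; have <- : #|~: (s |: B)| = (#|T| - #|B|.+1)%N.
  by rewrite [LHS]cardsCs setCK cardsU1 sB.
rewrite -cards_draws.
rewrite -[RHS](@card_in_imset _ _ (fun S => s |: S)); last first.
  move=> S1 S2; rewrite !inE => /andP[/subsetP S1s _] /andP[/subsetP S2s _] e.
  have sS (S : {set T}) : {subset S <= ~: (s |: B)} -> (s |: S) :\ s = S.
    by move=> h; rewrite setU1K //; apply/negP => /h; rewrite !inE eqxx.
  by rewrite -(sS _ S1s) -(sS _ S2s) e.
apply: eq_card => S; rewrite !inE; apply/and3P/imsetP.
- case=> cS sS dS; exists (S :\ s); last by rewrite setD1K.
  move: cS; rewrite (cardsD1 s) sS add1n eqSS inE => ->; rewrite andbT.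
  apply/subsetP => x; rewrite !inE => /andP[/negbTE-> xS] /=.
  by rewrite (disjointFr dS).
- case=> S'; rewrite inE => /andP[/subsetP hS /eqP cS] ->.
  have sS' : s \notin S' by apply/negP => /hS; rewrite !inE eqxx.
  split; rewrite ?setU11 ?cardsU1 ?sS' ?cS //.
  apply/pred0P => x /=; rewrite !inE; apply/negP => /andP[/orP[/eqP->|/hS]].
    by rewrite (negbTE sB).
  by rewrite !inE negb_or => /andP[_ /negbTE->].
Qed.

Section Counting.
Variable n : nat.
Implicit Types (S : {set 'I_n}) (s a b : 'I_n).

Definition separated S s a b : rat :=
  (s \in S)%:R * ((a \notin S)%:R * (b \notin S)%:R).

Lemma separatedE S s a b :
  separated S s a b = ((s \in S) && [disjoint S & [set a; b]])%:R.
Proof.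
rewrite /separated -!natrM !mulnb; congr (_ && _)%:R.
by rewrite disjoint_sym -setI_eq0 setIUl setU_eq0 !setI_eq0 !disjoints1.
Qed.

(** The positions [s], [a], [b] take up two or three places, and the other [k] elements of [S] are
    drawn from the rest. *)
Lemma sum_separated k s a b : a != s -> b != s ->
  \sum_(S : {set 'I_n} | #|S| == k.+1) separated S s a b =
  if a == b then 'C(n - 2, k)%:R else 'C(n - 3, k)%:R.
Proof.
move=> a_s b_s; under eq_bigr do rewrite separatedE.
have sab : s \notin [set a; b] by rewrite !inE negb_or ![s == _]eq_sym a_s b_s.
rewrite -natr_sum -big_mkcondr sum1dep_card card_draws_avoiding // card_ord cards2.
by case: eqVneq.
Qed.

Lemma sum_ord_lt (s : 'I_n) : \sum_(a < n) (a < s)%N%:R = s%:R :> rat.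
Proof.
rewrite -natr_sum -big_mkcond -(big_ord_widen n (fun=> 1%N)) ?sum1_card ?card_ord //.
exact: ltnW.
Qed.

Lemma sum_ord_gt (s : 'I_n) : \sum_(b < n) (s < b)%N%:R = n%:R - 1 - s%:R :> rat.
Proof.
have : \sum_(b < n) ((b < s)%N%:R + (b == s)%:R + (s < b)%N%:R) = n%:R :> rat.
  rewrite -[n in RHS]card_ord -sum1_card natr_sum; apply: eq_bigr => b _.
  by rewrite -val_eqE /=; case: ltngtP.
rewrite !big_split /= sum_ord_lt -[X in _ + X + _]natr_sum -big_mkcond big_pred1_eq => <-.
by ring.
Qed.

(** Double counting: each of the ['C(n, 3)] triples [a < s < b] is separated by ['C(n - 3, k)]
    sets. *)
Lemma sum_fixed_between k :
  \sum_(S : {set 'I_n} | #|S| == k.+1) fixed_between n S =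
  'C(n - 3, k)%:R * (n%:R * (n%:R - 1) * (n%:R - 2) / 6).
Proof.
transitivity (\sum_(s < n) \sum_(a < n) \sum_(b < n) (a < s)%N%:R * (s < b)%N%:R *
    \sum_(S : {set 'I_n} | #|S| == k.+1) separated S s a b).
  rewrite exchange_big; apply: eq_bigr => s _.
  under eq_bigr do rewrite big_distrlr mulr_sumr.
  rewrite exchange_big; apply: eq_bigr => a _.
  under eq_bigr do rewrite mulr_sumr.
  rewrite exchange_big; apply: eq_bigr => b _.
  by rewrite mulr_sumr; apply: eq_bigr => S _; rewrite /separated /=; ring.
transitivity (\sum_(s < n) 'C(n - 3, k)%:R * (s%:R * (n%:R - 1 - s%:R)) : rat).
  apply: eq_bigr => s _; rewrite -sum_ord_gt -sum_ord_lt big_distrlr mulr_sumr.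
  apply: eq_bigr => a _; rewrite mulr_sumr; apply: eq_bigr => b _ /=.
  case: ltnP => [a_s|_]; last by rewrite !(mul0r, mulr0).
  case: ltnP => [s_b|_]; last by rewrite !(mul0r, mulr0).
  rewrite sum_separated; first 1 last.
  - by rewrite -val_eqE /= ltn_eqF.
  - by rewrite -val_eqE /= gtn_eqF.
  by rewrite -val_eqE /= ltn_eqF ?(ltn_trans a_s) // mulrC.
rewrite -mulr_sumr; congr (_ * _).
(* The parameter [t], later [n - 1], is kept apart from [N] so that the induction leaves it
   fixed. *)
have gen N (t : rat) : \sum_(s < N) (s%:R * (t - s%:R)) =
    t * (N%:R * (N%:R - 1)) / 2 - (N%:R - 1) * N%:R * (2 * N%:R - 1) / 6.
  elim: N => [|N IHN]; first by rewrite big_ord0; field.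
  by rewrite big_ord_recr /= IHN -[N.+1]addn1 natrD; field.
by rewrite gen; field.
Qed.

(** Coinciding positions above [s] give ['C(n, 2)] choices with ['C(n - 2, k)] sets each; distinct
    ones give twice ['C(n, 3)] choices with ['C(n - 3, k)] sets each. *)
Lemma sum_fixed_below_pairs k :
  \sum_(S : {set 'I_n} | #|S| == k.+1) fixed_below_pairs n S =
  'C(n - 2, k)%:R * (n%:R * (n%:R - 1) / 2)
  + 'C(n - 3, k)%:R * (n%:R * (n%:R - 1) * (n%:R - 2) / 3).
Proof.
transitivity (\sum_(s < n) \sum_(a < n) \sum_(b < n) (s < a)%N%:R * (s < b)%N%:R *
    \sum_(S : {set 'I_n} | #|S| == k.+1) separated S s a b).
  rewrite exchange_big; apply: eq_bigr => s _.
  under eq_bigr do rewrite big_distrlr mulr_sumr.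
  rewrite exchange_big; apply: eq_bigr => a _.
  under eq_bigr do rewrite mulr_sumr.
  rewrite exchange_big; apply: eq_bigr => b _.
  by rewrite mulr_sumr; apply: eq_bigr => S _; rewrite /separated /=; ring.
transitivity (\sum_(s < n)
  (('C(n - 2, k)%:R - 'C(n - 3, k)%:R) * (n%:R - 1 - s%:R)
   + 'C(n - 3, k)%:R * (n%:R - 1 - s%:R) ^+ 2) : rat).
  apply: eq_bigr => s _; rewrite -sum_ord_gt expr2 big_distrlr !mulr_sumr.
  rewrite -big_split; apply: eq_bigr => a _ /=.
  (* The diagonal correction is spread as a sum over [b], so that both sides compare term by
     term. *)
  have -> : ('C(n - 2, k)%:R - 'C(n - 3, k)%:R) * (s < a)%N%:R =
    \sum_(b < n) (if b == a then ('C(n - 2, k)%:R - 'C(n - 3, k)%:R) * (s < a)%N%:R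
                  else 0) :> rat by rewrite -big_mkcond big_pred1_eq.
  rewrite mulr_sumr -big_split; apply: eq_bigr => b _ /=.
  have [->|b_a] := eqVneq b a.
    case: ltnP => [s_a|_]; last by rewrite !(mul0r, mulr0, addr0).
    have a_s : a != s by rewrite -val_eqE /= gtn_eqF.
    by rewrite sum_separated // eqxx -[true%:R]/(1 : rat); ring.
  case: ltnP => [s_a|_]; last by rewrite !(mul0r, mulr0, addr0).
  case: ltnP => [s_b|_]; last by rewrite !(mul0r, mulr0, addr0).
  have as_ : a != s by rewrite -val_eqE /= gtn_eqF.
  have bs_ : b != s by rewrite -val_eqE /= gtn_eqF.
  by rewrite sum_separated // eq_sym (negbTE b_a) -[true%:R]/(1 : rat); ring.
rewrite big_split /= -!mulr_sumr.
have gen1 N (t : rat) : \sum_(s < N) (t - s%:R) = t * N%:R - N%:R * (N%:R - 1) / 2.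
  elim: N => [|N IHN]; first by rewrite big_ord0; field.
  by rewrite big_ord_recr /= IHN -[N.+1]addn1 natrD; field.
have gen2 N (t : rat) : \sum_(s < N) (t - s%:R) ^+ 2 =
    t ^+ 2 * N%:R - t * (N%:R * (N%:R - 1)) + (N%:R - 1) * N%:R * (2 * N%:R - 1) / 6.
  elim: N => [|N IHN]; first by rewrite big_ord0; field.
  by rewrite big_ord_recr /= IHN -[N.+1]addn1 natrD; field.
by rewrite gen1 gen2; field.
Qed.

Lemma fixed_between0 : fixed_between n set0 = 0.
Proof. by apply: big1 => i _; rewrite inE mul0r. Qed.

Lemma fixed_below_pairs0 : fixed_below_pairs n set0 = 0.
Proof. by apply: big1 => i _; rewrite inE mul0r. Qed.

Lemma invc_derangements_inclusion_exclusion c :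
  (invc_derangements n c)%:R =
  \sum_(S : {set 'I_n}) (-1) ^+ #|S| *
    \sum_(p | perm_on (~: S) p)
      \sum_(f : {ffun 'I_n -> 'I_c} | zero_on n c S f) (invc (p, f))%:R :> rat.
Proof.
rewrite /invc_derangements natr_sum big_mkcond /=.
under eq_bigr => s _.
  rewrite -[if _ then _ else _]mulrb -[_ *+ _]mulr_natl.
  rewrite /colored_derangement (inclusion_exclusion _ _
    (fun i => (uperm s i == i) && (color s i == 0 :> nat))) mulr_suml.
  under eq_bigr do rewrite -mulrA.
  over.
rewrite exchange_big; apply: eq_bigr => S _; rewrite -mulr_sumr; congr (_ * _).
rewrite pair_big [RHS]big_mkcond; apply: eq_bigr => -[p f] _ /=.
(* Being fixed with color 0 on [S] decouples into a condition on [p] and one on [f]. *)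
have -> : [forall i in S, (uperm (p, f) i == i) && (color (p, f) i == 0 :> nat)]
   = perm_on (~: S) p && zero_on n c S f; last by case: (_ && _); rewrite ?mul1r ?mul0r.
apply/forall_inP/andP => [h|[pS /forall_inP f0] i iS]; last first.
  by rewrite /color f0 // /uperm (out_perm pS) ?eqxx // inE iS.
split; last by apply/forall_inP => i /h /andP[].
by apply/subsetP => i; rewrite !inE; apply: contraNN => /h /andP[].
Qed.

Lemma invc_derangements_by_size c : (0 < c)%N ->
  (invc_derangements n c)%:R =
  \sum_(0 <= k < n.+1) (-1) ^+ k * (c%:R ^+ (n - k) *
     ('C(n, k)%:R * ((n - k)`!)%:R
        * ((n - k)%:R * ((n - k)%:R - 1) / 4 + (n - k)%:R * (c%:R - 1) / 2
           + (c%:R - 1) * ((n - k)%:R * ((n - k)%:R - 1)) / 4)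
      + ((n - k).-1)`!%:R *
        (2 * (\sum_(S : {set 'I_n} | #|S| == k) fixed_between n S)
         + (c%:R - 1) *
           (\sum_(S : {set 'I_n} | #|S| == k) fixed_below_pairs n S)))) :> rat.
Proof.
move=> c_gt0; rewrite invc_derangements_inclusion_exclusion big_mkord.
have card_lt (S : {set 'I_n}) : (#|S| < n.+1)%N.
  by rewrite ltnS -[n in (_ <= n)%N]card_ord max_card.
(* Group the sets by cardinality, viewed as an element of ['I_n.+1]. *)
rewrite (partition_big (fun S : {set 'I_n} => Ordinal (card_lt S)) xpredT) //=.
apply: eq_bigr => k _.
under eq_bigr => S /eqP/(congr1 val)/= cS.
  rewrite sum_invc_fixing // cardsCs setCK card_ord cS.
  over.
rewrite -2!mulr_sumr big_split /= sumr_const -mulr_sumr big_split /= -!mulr_sumr.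
congr (_ * (_ * (_ + _))).
have -> : #|[pred S : {set 'I_n} | Ordinal (card_lt S) == k]| = 'C(n, k).
  rewrite -[n in 'C(n, _)]card_ord -card_draws -sum1dep_card -sum1_card.
  by apply: eq_bigl => S; rewrite inE -val_eqE.
by rewrite -[RHS]mulrA [RHS]mulr_natl.
Qed.

End Counting.

(** * Factorial identities and term-by-term comparison *)

Lemma natr_bin2 m : 'C(m, 2)%:R = m%:R * (m%:R - 1) / 2 :> rat.
Proof.
elim: m => [|m IHm]; first by rewrite mul0r.
by rewrite binS natrD bin1 IHm -[m.+1]addn1 natrD; field.
Qed.

Lemma natr_bin_fact m k : 'C(m + k, k)%:R = (m + k)`!%:R / (k`!%:R * m`!%:R) :> rat.
Proof.
rewrite -(@bin_fact (m + k) k) ?leq_addl // addnK !natrM mulfK //.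
by rewrite mulf_neq0 // pnatr_eq0 -lt0n fact_gt0.
Qed.

(* The factor [0 < m] absorbs the truncated subtractions when [m = 0]. *)
Lemma fact_pred_bin_sub2 m k n : n = (m + k.+1)%N ->
  (m.-1)`!%:R * ('C(n - 2, k)%:R * (n%:R * (n%:R - 1)))
  = (0 < m)%N%:R * n`!%:R / k`!%:R :> rat.
Proof.
move=> ->; case: m => [|m] /=.
  case: k => [|k]; first by rewrite subrr !(mulr0, mul0r).
  by rewrite add0n subSS subn1 bin_small // !(mulr0, mul0r).
have k0 : k`!%:R != 0 :> rat by rewrite pnatr_eq0 -lt0n fact_gt0.
have m0 : m`!%:R != 0 :> rat by rewrite pnatr_eq0 -lt0n fact_gt0.
have -> : (m.+1 + k.+1 = (m + k).+2)%N by lia.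
rewrite subSS subSS subn0 natr_bin_fact !factS !natrM.
rewrite -[(m + k).+2]addn2 -[(m + k).+1]addn1 !natrD.
by field; rewrite k0 m0.
Qed.

(** For [m <= 1], where [n - 3] may be truncated, both sides vanish; otherwise [n - 3] is
    [(m - 2) + k] and the identity is one of factorials. *)
Lemma fact_pred_bin_sub3 m k n : n = (m + k.+1)%N ->
  (m.-1)`!%:R * ('C(n - 3, k)%:R * (n%:R * (n%:R - 1) * (n%:R - 2)))
  = (0 < m)%N%:R * (m%:R - 1) * n`!%:R / k`!%:R :> rat.
Proof.
move=> ->; case: m => [|[|m]] /=.
- case: k => [|[|k]]; rewrite ?subrr ?(mulr0, mul0r) //.
  by rewrite add0n bin_small ?(mulr0, mul0r) //; lia.
- case: k => [|k]; rewrite ?subrr ?(mulr0, mul0r) //.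
  by rewrite bin_small ?(mulr0, mul0r) //; lia.
have k0 : k`!%:R != 0 :> rat by rewrite pnatr_eq0 -lt0n fact_gt0.
have m0 : m`!%:R != 0 :> rat by rewrite pnatr_eq0 -lt0n fact_gt0.
have -> : (m.+2 + k.+1 = (m + k).+3)%N by lia.
have -> : ((m + k).+3 - 3 = m + k)%N by lia.
rewrite natr_bin_fact !factS !natrM -[(m + k).+3]addn3 -[(m + k).+2]addn2.
rewrite -[(m + k).+1]addn1 -[m.+2]addn2 -[m.+1]addn1 !natrD.
by field; rewrite k0 m0.
Qed.

(** The guards [k < n] and [0 < k < n] encode the shorter ranges of the first and last sums, so that
    the formula can be checked for each [k] separately. *)
Lemma term_by_size n c k (x := c%:R ^+ (n - k)%N : rat) (q := c%:R : rat) : (k <= n)%N ->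
  (-1) ^+ k * (x *
     ('C(n, k)%:R * ((n - k)`!)%:R
        * ((n - k)%:R * ((n - k)%:R - 1) / 4 + (n - k)%:R * (q - 1) / 2
           + (q - 1) * ((n - k)%:R * ((n - k)%:R - 1)) / 4)
      + ((n - k).-1)`!%:R *
        (2 * (\sum_(S : {set 'I_n} | #|S| == k) fixed_between n S)
         + (q - 1) *
           (\sum_(S : {set 'I_n} | #|S| == k) fixed_below_pairs n S)))) =
  n`!%:R / 12 * (if (k < n)%N then
      (-1) ^+ k * (x * (n%:R - k%:R - 1) * (3 * n%:R + k%:R) / k`!%:R) else 0)
  + n`!%:R * ((-1) ^+ k / k`!%:R * ((n - k)%:R * x * (q - 1) / 2))
  + n`!%:R * (q - 1) / 2 * ((-1) ^+ k * x / k`!%:R * 'C(n - k, 2)%:R)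
  + n`!%:R * (q - 1) / 6 * (if (0 < k < n)%N then
      (-1) ^+ k * x * (2 * (n%:R - k%:R) + 1) / (k - 1)`!%:R else 0).
Proof.
move=> kn; set m := (n - k)%N; rewrite -natrB // -/m.
have nE : n = (m + k)%N by rewrite subnK.
have k0 : k`!%:R != 0 :> rat by rewrite pnatr_eq0 -lt0n fact_gt0.
have m0 : m`!%:R != 0 :> rat by rewrite pnatr_eq0 -lt0n fact_gt0.
have -> : 'C(n, k)%:R = n`!%:R / (k`!%:R * m`!%:R) :> rat by rewrite nE natr_bin_fact.
have -> : (k < n)%N = (0 < m)%N by rewrite subn_gt0.
have -> : n%:R = m%:R + k%:R :> rat by rewrite nE natrD.
rewrite natr_bin2; case: k @x kn @m nE k0 m0 => [|k] x kn m nE k0 m0.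
  (* For [k = 0] only the empty set occurs, and both position counts are zero. *)
  have S0 (h : {set 'I_n} -> rat) : h set0 = 0 ->
      \sum_(S : {set 'I_n} | #|S| == 0) h S = 0.
    by move=> h0; apply: big1 => S; rewrite cards_eq0 => /eqP->.
  rewrite !S0 ?fixed_between0 ?fixed_below_pairs0 //=.
  case: ltnP => [_|]; first by rewrite fact0; field.
  by rewrite leqn0 => /eqP->; rewrite fact0; field.
have h2 := fact_pred_bin_sub2 _ _ _ nE; have h3 := fact_pred_bin_sub3 _ _ _ nE.
rewrite sum_fixed_between sum_fixed_below_pairs subn1 /=.
set C2 := 'C(n - 2, k)%:R in h2 *; set C3 := 'C(n - 3, k)%:R in h3 *.
set P := (m.-1)`!%:R in h2 h3 *.
(* Regrouped to expose the left sides of [h2] and [h3]; the coefficient of the latter is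
   [2/6 + (q - 1)/3 = q/3]. *)
have -> : P * (2 * (C3 * (n%:R * (n%:R - 1) * (n%:R - 2) / 6)) +
    (q - 1) * (C2 * (n%:R * (n%:R - 1) / 2) +
      C3 * (n%:R * (n%:R - 1) * (n%:R - 2) / 3))) =
  P * (C3 * (n%:R * (n%:R - 1) * (n%:R - 2))) * q / 3
  + P * (C2 * (n%:R * (n%:R - 1))) * (q - 1) / 2 by field.
rewrite h2 h3.
have kf0 : k`!%:R != 0 :> rat by rewrite pnatr_eq0 -lt0n fact_gt0.
have kS0 : k%:R + 1 != 0 :> rat by rewrite -(natrD _ k 1) pnatr_eq0 addn1.
rewrite factS natrM -[k.+1]addn1 !natrD.
case: (ltnP 0 m) => [_|].
  by rewrite -[true%:R]/(1 : rat); field; rewrite kf0 kS0 m0.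
rewrite leqn0 => /eqP ->; rewrite -[false%:R]/(0 : rat).
by field; rewrite kf0 kS0.
Qed.

Lemma inner_sum_colors m c : (0 < c)%N ->
  \sum_(0 <= i < (m * (c - 1)).+1) i%:R *
    (\sum_(0 <= j < m.+1) (-1) ^+ j * 'C(m, j)%:R *
      (binz (i%:Z - c%:Z * j%:Z + m%:Z - 1) (m%:Z - 1))%:R)
  = m%:R * c%:R ^+ m * (c%:R - 1) / 2 :> rat.
Proof.
(* For [m = 0] the lower index of [binz] is -1, but the only term has weight [i = 0]. *)
case: m => [|m] c_gt0; first by rewrite big_nat1 !mul0r.
rewrite -sum_color_totals // mulrAC mulfV // mul1r.
by apply: eq_bigr => i _; rewrite binz_coef.
Qed.

Theorem theorem4p2 (n c : nat) (hc : (1 <= c)%N) :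
  (invc_derangements n c)%:R =
    (n`!)%:R / 12%:R *
      (\sum_(0 <= k < n)
         (-1) ^+ k * (c%:R ^+ (n - k)%N * (n%:R - k%:R - 1) * (3%:R * n%:R + k%:R)
                      / (k`!)%:R))
  + (n`!)%:R *
      (\sum_(0 <= k < n.+1)
         (-1) ^+ k / (k`!)%:R *
         (\sum_(0 <= i < ((n - k) * (c - 1)).+1)
            i%:R *
            (\sum_(0 <= j < (n - k).+1)
               (-1) ^+ j * ('C(n - k, j))%:R *
               (binz (i%:Z - c%:Z * j%:Z + n%:Z - k%:Z - 1)
                     (n%:Z - k%:Z - 1))%:R)))
  + (n`!)%:R * (c%:R - 1) / 2%:R *
      (\sum_(0 <= k < n.+1)
         (-1) ^+ k * c%:R ^+ (n - k)%N / (k`!)%:R * ('C(n - k, 2))%:R)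
  + (n`!)%:R * (c%:R - 1) / 6%:R *
      (\sum_(1 <= k < n)
         (-1) ^+ k * c%:R ^+ (n - k)%N * (2%:R * (n%:R - k%:R) + 1)
         / ((k - 1)`!)%:R)
  :> rat.
Proof.
rewrite invc_derangements_by_size //.
(* All sums over [k] are brought to the range from 0 to [n], with guards, and merged into one. *)
rewrite (big_nat_widen 0 n n.+1) // [\sum_(1 <= k < n) _](big_nat_widen 1 n n.+1) //.
rewrite [\sum_(1 <= k < n.+1 | _) _](big_nat_widenl 1 0) //.
rewrite [\sum_(0 <= k < n.+1 | (k < n)%N) _]big_mkcond.
rewrite [\sum_(0 <= k < n.+1 | _ && _) _]big_mkcond /=.
rewrite !mulr_sumr -!big_split /= !big_mkord; apply: eq_bigr => k _.
have kn : (k <= n)%N by rewrite -ltnS.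
rewrite term_by_size //; congr (_ + _ * (_ * _) + _ + _ * _).
  (* The double sum is the one for [m = n - k]; as [k <= n], the truncated difference agrees with
     the integer one. *)
  rewrite -inner_sum_colors //; apply: eq_bigr => i _; congr (_ * _).
  apply: eq_bigr => j _; congr (_ * (binz _ _)%:R); lia.
by rewrite andbC.
Qed.
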